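(* Let $A\in\mathbb{R}^{n\times n}$ be a matrix all of whose eigenvalues lie in $\mathbb{C}\setminus(-\infty,0]$, and suppose that $A\neq I$. Let $\theta>0$ be a lower bound on $\|\log(A)\|_2$ (i.e. $\theta\le\|\log(A)\|_2$), let the tolerance $\epsilon>0$ satisfy $$\epsilon<\frac{3\|A-I\|_2\|A^{-1}\|_2}{\theta(1+\|A^{-1}\|_2)},$$ and let $s$ be a real positive solution of the equation $$\frac{1}{\theta}\left(-\log(s)+\frac{1-s}{2s}\right)\|A-I\|_2\|A^{-1}\|_2=\frac{\epsilon}{2}.$$ If $$l:=\mathrm{asinh}(\mathrm{atanh}(2a-1)),\qquad r:=\mathrm{asinh}(\mathrm{atanh}(2b-1)),$$ where $$a:=\min\left\{\frac{\theta\epsilon}{3\|A-I\|_2},\ \frac{1}{2\|A-I\|_2}\right\},\qquad b:=\max\left\{s,\ \frac{2\|A^{-1}\|_2}{2\|A^{-1}\|_2+1}\right\},$$ then $$\frac{\left\lVert \log(A)-(A-I)\int_l^r F_{\mathrm{DE}}(x)\,\mathrm{d}x\right\rVert_2}{\|\log(A)\|_2}\le\epsilon.$$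
   Context: $I$ is the $n\times n$ identity matrix and $\|\cdot\|_2$ is the matrix 2-norm (spectral norm). For $A\in\mathbb{R}^{n\times n}$ with all eigenvalues in $\mathbb{C}\setminus(-\infty,0]$, $\log(A)$ denotes the principal logarithm: the unique matrix $X$ with $\exp(X)=A$ all of whose eigenvalues lie in the strip $\{z\in\mathbb{C}:-\pi<\mathrm{Im}(z)<\pi\}$. For $x\in\mathbb{R}$, $$F_{\mathrm{DE}}(x):=\cosh(x)\,\mathrm{sech}^2(\sinh(x))\left[(1+\tanh(\sinh(x)))(A-I)+2I\right]^{-1},$$ where the matrix in brackets is nonsingular for every $x\in\mathbb{R}$ under the eigenvalue assumption on $A$. Integrals of matrix-valued functions are entrywise. $\mathrm{asinh}$ and $\mathrm{atanh}$ are the inverse functions of $\sinh$ and $\tanh$. $\log(s)$ for a positive scalar $s$ is the natural logarithm. *)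

(* Defs.v *)
From HB Require Import structures.
From mathcomp Require Import all_boot all_order all_algebra.
From mathcomp Require Import all_classical all_reals all_analysis.
From mathcomp Require Import complex.

Set Implicit Arguments.
Unset Strict Implicit.
Unset Printing Implicit Defensive.

Import Order.TTheory GRing.Theory Num.Theory.
Import numFieldNormedType.Exports.

Local Open Scope classical_set_scope.
Local Open Scope ring_scope.

Section Hyperbolic.
Variable R : realType.
Implicit Types x y : R.

Definition sinh x : R := (expR x - expR (- x)) / 2.
Definition cosh x : R := (expR x + expR (- x)) / 2.
Definition tanh x : R := sinh x / cosh x.
Definition sech x : R := (cosh x)^-1.

Definition asinh y : R := get [set x | sinh x = y].
(* meaningful for -1 < y < 1 only; unspecified elsewhere *)
Definition atanh y : R := get [set x | tanh x = y].

End Hyperbolic.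

Section RealMatrices.
Variables (R : realType) (n : nat).
Implicit Types A X : 'M[R]_n.

(* [eigenvalue] uses row eigenvectors; the spectrum is the same as with
   column eigenvectors. *)
Definition complex_eigenvalue A (z : R[i]) : bool :=
  eigenvalue (map_mx (real_complex R) A) z.

Definition norm2 (v : 'cV[R]_n) : R := Num.sqrt (\sum_i v i 0 ^+ 2).

Definition specnorm A : R :=
  sup [set norm2 (A *m v) | v in [set v : 'cV[R]_n | norm2 v = 1]].

Definition expmx X : 'M[R]_n :=
  \matrix_(i, j) limn (series (fun k => (k`!%:R^-1 *: X ^+ k) i j)).

Definition is_principal_log A X : Prop :=
  expmx X = A /\
  forall z : R[i], complex_eigenvalue X z ->
    - pi < complex.Im z < pi.

(* The principal logarithm of a real matrix without eigenvalues in ]-oo, 0] is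
   itself real, so X ranges over real matrices. *)
Definition logmx A : 'M[R]_n := get [set X | is_principal_log A X].

Definition oriented_integral (l r : R) (f : R -> R) : R :=
  if l <= r then Rintegral (@lebesgue_measure R) `[l, r] f
  else - Rintegral (@lebesgue_measure R) `[r, l] f.

Definition integral_mx (l r : R) (F : R -> 'M[R]_n) : 'M[R]_n :=
  \matrix_(i, j) oriented_integral l r (fun x => F x i j).

Definition F_DE A (x : R) : 'M[R]_n :=
  (cosh x * sech (sinh x) ^+ 2) *:
    invmx ((1 + tanh (sinh x)) *: (A - 1%:M) + 2 *: 1%:M).

End RealMatrices.

(* Main.v *)
Require Import Defs.
From mathcomp Require Import all_boot all_order all_algebra.
From mathcomp Require Import all_classical all_reals all_analysis.
From mathcomp Require Import complex spectral ring lra.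

Set Implicit Arguments.
Unset Strict Implicit.
Unset Printing Implicit Defensive.

Import Order.TTheory GRing.Theory Num.Theory.
Import numFieldNormedType.Exports.
Local Open Scope classical_set_scope.
Local Open Scope ring_scope.

(** Write E = A - 1, e = |E| and N = |A^-1|, with spectral norms. Two facts reduce
    the theorem to an estimate of an integral over the two ends of [0, 1].

    First, the principal logarithm is log A = int_0^1 E (1 + t E)^-1 dt
    ([log_integral]). If X is a logarithm of A whose eigenvalues lie in the strip
    |Im z| < pi, then no matrix exp(sX) with |s| <= 1 has an eigenvalue in
    ]-oo, 0] ([expmx_eigenvalue_gt0]), so 1 + t (exp(sX) - 1) is invertible for t in
    [0, 1] ([homotopy_unitmx]). Putting exp(sX) in place of A in the integral and
    differentiating in s gives the constant X: the derivative of the integrand in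
    s is a derivative in t ([resolvent_closed_form]), and the integral over t
    collapses to boundary terms. The formula therefore holds at s = 1, since it
    holds at s = 0.

    Second, t = (1 + tanh (sinh x)) / 2 turns F_DE(x) dx into (1 + t E)^-1 dt
    and takes the values a at l and b at r ([integral_F_DE],
    [de_subst_asinh_atanh]). With a primitive Phi of the resolvent
    ([resolvent_primitive]) the error is
    E (Phi(a) - Phi(0)) + E (Phi(1) - Phi(b)).

    Both tails are estimated after pairing with unit vectors, by comparing the
    derivative of the resulting real function with that of an explicit majorant.
    For t <= a the Neumann-type bound 1 / (1 - t e) <= 1 + 2 t e applies because
    a e <= 1/2, and yields a e + (a e)^2 <= 3 a e / 2 <= theta epsilon / 2
    ([lower_tail]). For t >= b write 1 + t E = (t + (1 - t) A^-1) A; the inverse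
    of the first factor has norm at most 1 / (t - (1 - t) N), and b is large enough
    for (1 - t) N <= t / 2. Integration gives
    e N (- ln b + (1 - b) / (2 b)) ([upper_tail]), which increases when b is
    lowered to s, where it equals theta epsilon / 2. The sum of the tails is thus at
    most theta epsilon <= epsilon |log A|. *)

(** * Derivatives of real functions and power series *)

Section RealCalculus.
Variable R : realType.
Implicit Types (f g : R -> R) (x df dg : R).

(** The pointwise forms below let the value of a derivative be assembled by
    plain application when the function is given by a formula in its variable. *)
Lemma is_derive_add f g x df dg : is_derive x 1 f df -> is_derive x 1 g dg ->
  is_derive x 1 (fun y => f y + g y) (df + dg).
Proof. exact: is_deriveD. Qed.

Lemma is_derive_mul f g x df dg : is_derive x 1 f df -> is_derive x 1 g dg ->
  is_derive x 1 (fun y => f y * g y) (df * g x + f x * dg).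
Proof.
move=> hf hg; apply: is_derive_eq (is_deriveM hf hg) _.
by rewrite /GRing.scale/= addrC mulrC.
Qed.

Lemma is_derive_opp f x df : is_derive x 1 f df ->
  is_derive x 1 (fun y => - f y) (- df).
Proof. exact: is_deriveN. Qed.

Lemma is_derive_comp f g x df dg : is_derive (g x) 1 f df ->
  is_derive x 1 g dg -> is_derive x 1 (fun y => f (g y)) (df * dg).
Proof. by move=> hf hg; apply: is_derive1_comp. Qed.

Lemma is_derive_bigsum n (h : 'I_n -> R -> R) (dh : 'I_n -> R) x :
  (forall i, is_derive x 1 (h i) (dh i)) ->
  is_derive x 1 (fun y => \sum_i h i y) (\sum_i dh i).
Proof.
move=> hd; have := @is_derive_sum R R R n h x 1 dh hd.
by congr is_derive; apply/funext => y; rewrite fct_sumE.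
Qed.

Lemma is_derive_continuous f x df : is_derive x 1 f df -> {for x, continuous f}.
Proof. by move=> [h _]; apply/differentiable_continuous/derivable1_diffP. Qed.

End RealCalculus.

Section PowerSeries.
Variable R : realType.
Implicit Types (c : R^nat) (x z K M : R).

(** Domination by a multiple of the exponential series of |K z|. *)
Lemma is_cvg_pseries_fact c M K : (forall k, `|c k| <= M * K ^+ k / k`!%:R) ->
  forall z, cvgn (pseries c z).
Proof.
move=> hc z; apply: normed_cvg.
have M0 : 0 <= M.
  by have := le_trans (normr_ge0 _) (hc 0%N); rewrite expr0 fact0 divr1 mulr1.
have hK : cvgn (series (M *: exp_coeff (`|K| * `|z|))).
  exact/is_cvg_seriesZ/is_cvg_series_exp_coeff.
apply: series_le_cvg hK => [k|k|k]; rewrite ?normr_ge0//.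
  by rewrite /GRing.scale/= /exp_coeff mulr_ge0// divr_ge0// exprn_ge0// mulr_ge0.
have -> : (M *: exp_coeff (`|K| * `|z|)) k
    = (M * `|K| ^+ k / k`!%:R) * `|z| ^+ k.
  rewrite [LHS](_ : _ = M * ((`|K| * `|z|) ^+ k / k`!%:R))// exprMn.
  by rewrite !mulrA mulrAC.
rewrite [leLHS]normrM normrX ler_wpM2r ?exprn_ge0//; apply: le_trans (hc k) _.
by rewrite ler_wpM2r ?invr_ge0// ler_wpM2l// -normrX ler_norm.
Qed.

End PowerSeries.

(** * The matrix exponential along a line *)

Section ExpMx.
Variables (R : realType) (n : nat).
Implicit Types (X Y : 'M[R]_n) (x : R).

Lemma exprS_mx X k : X ^+ k.+1 = X *m X ^+ k.
Proof. by rewrite exprS. Qed.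

Lemma exprZ_mx x X k : (x *: X) ^+ k = x ^+ k *: X ^+ k.
Proof.
elim: k => [|k IHk]; first by rewrite !expr0 scale1r.
by rewrite !exprS_mx IHk -scalemxAl -scalemxAr scalerA -exprS.
Qed.

(** The sum of all |X a b| is a submultiplicative size, and it dominates every
    entry; this is enough to make all the entrywise series below converge. *)
Lemma normr_expr_mx X k i j :
  `|(X ^+ k) i j| <= (\sum_a \sum_b `|X a b|) ^+ k.
Proof.
elim: k i j => [|k IHk] i j.
  rewrite expr0 expr0 [1%R]/(1%:M) mxE normr_nat lern1; exact: leq_b1.
rewrite exprS_mx mxE; apply: le_trans (ler_norm_sum _ _ _) _.
rewrite exprS; apply: (@le_trans _ _ (\sum_l `|X i l| * (\sum_a \sum_b `|X a b|) ^+ k)).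
  by apply: ler_sum => l _; rewrite normrM ler_wpM2l.
rewrite -mulr_suml ler_wpM2r ?exprn_ge0//.
  by apply: sumr_ge0 => a _; apply: sumr_ge0.
rewrite [leRHS](bigD1 i)//= lerDl.
by apply: sumr_ge0 => a _; apply: sumr_ge0.
Qed.

Lemma normr_mulmx_expmx_coeff Y X i j k :
  `|k`!%:R^-1 * (Y *m X ^+ k) i j|
    <= (\sum_l `|Y i l|) * (\sum_a \sum_b `|X a b|) ^+ k / k`!%:R.
Proof.
rewrite normrM ger0_norm ?invr_ge0// mulrC ler_wpM2r ?invr_ge0// mxE.
apply: le_trans (ler_norm_sum _ _ _) _; rewrite mulr_suml.
by apply: ler_sum => l _; rewrite normrM ler_wpM2l// normr_expr_mx.
Qed.

Lemma expmx_scaleE x X i j :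
  expmx (x *: X) i j = limn (pseries (fun k => k`!%:R^-1 * (X ^+ k) i j) x).
Proof.
rewrite mxE; congr (limn (series _)); apply/funext => k.
by rewrite exprZ_mx !mxE/= mulrCA mulrC.
Qed.

Lemma is_cvg_expmx x X i j :
  cvgn (pseries (fun k => k`!%:R^-1 * (X ^+ k) i j) x).
Proof.
apply: is_cvg_pseries_fact => k; have := normr_mulmx_expmx_coeff 1%:M X i j k.
by rewrite mul1mx; exact.
Qed.

Lemma mulmx_expmxE Y x X i j : (Y *m expmx (x *: X)) i j =
  limn (pseries (fun k => k`!%:R^-1 * (Y *m X ^+ k) i j) x).
Proof.
apply/esym/cvg_lim => //; rewrite mxE.
under eq_bigr do rewrite expmx_scaleE.
have -> : pseries (fun k => k`!%:R^-1 * (Y *m X ^+ k) i j) x =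
    fun N => \sum_l (Y i l * pseries (fun k => k`!%:R^-1 * (X ^+ k) l j) x N).
  apply/funext => N; rewrite /pseries /series/=.
  under [RHS]eq_bigr do rewrite mulr_sumr.
  rewrite exchange_big/=; apply: eq_bigr => k _.
  rewrite mxE mulr_sumr mulr_suml; apply: eq_bigr => l _.
  by rewrite mulrCA !mulrA.
apply: (@cvg_big _ _ +%R 0 xpredT); first exact: add_continuous.
by move=> l _; apply: cvgMr; exact: is_cvg_expmx.
Qed.

Lemma expmx_mulmxE Y x X i j : (expmx (x *: X) *m Y) i j =
  limn (pseries (fun k => k`!%:R^-1 * (X ^+ k *m Y) i j) x).
Proof.
apply/esym/cvg_lim => //; rewrite mxE.
under eq_bigr do rewrite expmx_scaleE.
have -> : pseries (fun k => k`!%:R^-1 * (X ^+ k *m Y) i j) x =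
    fun N => \sum_l (pseries (fun k => k`!%:R^-1 * (X ^+ k) i l) x N * Y l j).
  apply/funext => N; rewrite /pseries /series/=.
  under [RHS]eq_bigr do rewrite mulr_suml.
  rewrite exchange_big/=; apply: eq_bigr => k _.
  rewrite mxE mulr_sumr mulr_suml; apply: eq_bigr => l _.
  by rewrite -!mulrA [_ * x ^+ k]mulrC.
apply: (@cvg_big _ _ +%R 0 xpredT); first exact: add_continuous.
by move=> l _; apply: cvgMl; exact: is_cvg_expmx.
Qed.

Lemma expmx_comm x X Y : comm_mx Y X -> comm_mx Y (expmx (x *: X)).
Proof.
move=> cYX; apply/matrixP => i j; rewrite mulmx_expmxE expmx_mulmxE.
congr (limn (pseries _ _)); apply/funext => k; congr (_ * fun_of_matrix _ _ _).
elim: k => [|k IHk]; first by rewrite expr0 mulmx1 mul1mx.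
by rewrite exprS_mx mulmxA cYX -mulmxA IHk mulmxA.
Qed.

Lemma expmx0 X : expmx (0 *: X) = 1%:M.
Proof.
apply/matrixP => i j; rewrite expmx_scaleE; apply: cvg_lim => //.
rewrite -(cvg_shiftS (pseries _ _)).
have -> : [sequence pseries (fun k => k`!%:R^-1 * (X ^+ k) i j) 0 m.+1]_m
    = cst ((1%:M : 'M[R]_n) i j).
  apply/funext => m; rewrite /pseries /series/= big_nat_recl//= big1 => [|k _].
    by rewrite expr0 fact0 invr1 mul1r mulr1 addr0.
  by rewrite expr0n/= mulr0.
exact: cvg_cst.
Qed.

(** Entrywise termwise differentiation. Multiplying the coefficients by a fixed
    Y on the left makes formal differentiation an iterable rule, Y |-> Y X, so
    that one bound covers the three series required for differentiability. *)
Lemma expmx_is_derive x X i j :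
  is_derive x 1 (fun y => expmx (y *: X) i j) ((X *m expmx (x *: X)) i j).
Proof.
have dE Y : pseries_diffs (fun k => k`!%:R^-1 * (Y *m X ^+ k) i j) =
    fun k => k`!%:R^-1 * ((Y *m X) *m X ^+ k) i j.
  apply/funext => k; rewrite /pseries_diffs exprS_mx mulmxA mulrA; congr (_ * _).
  by rewrite factS natrM invfM mulVKf.
have cE : (fun k => k`!%:R^-1 * (X ^+ k) i j) =
    fun k => k`!%:R^-1 * (1%:M *m X ^+ k) i j.
  by apply/funext => k; rewrite mul1mx.
have cv Y z : cvgn (pseries (fun k => k`!%:R^-1 * (Y *m X ^+ k) i j) z).
  by apply: is_cvg_pseries_fact; exact: normr_mulmx_expmx_coeff.
have := @pseries_snd_diffs R (fun k => k`!%:R^-1 * (X ^+ k) i j) (`|x| + 1) x.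
rewrite cE !dE mul1mx => /(_ (cv _ _) (cv _ _) (cv _ _)).
rewrite [`|_ + 1|]ger0_norm ?addr_ge0// ltrDl ltr01 => /(_ isT).
rewrite -mulmx_expmxE -cE; congr is_derive.
by apply/funext => y; rewrite expmx_scaleE.
Qed.

End ExpMx.

(** * Entrywise limits and derivatives of matrix-valued functions *)

Section MatrixLimits.
Variable R : realType.

Definition mxcvg T (F : set_system T) m n (G : T -> 'M[R]_(m, n)) (M : 'M[R]_(m, n)) :=
  forall i j, G h i j @[h --> F] --> M i j.

Context {T : Type} {F : set_system T} {FF : Filter F}.

Lemma mxcvg_cst m n (M : 'M[R]_(m, n)) : mxcvg F (fun=> M) M.
Proof. by move=> i j; exact: cvg_cst. Qed.

Lemma mxcvgD m n (G H : T -> 'M[R]_(m, n)) M N :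
  mxcvg F G M -> mxcvg F H N -> mxcvg F (fun h => G h + H h) (M + N).
Proof.
move=> hG hH i j; rewrite mxE; under eq_cvg do rewrite mxE.
exact: cvgD (hG i j) (hH i j).
Qed.

Lemma mxcvgZ m n (f : T -> R) (G : T -> 'M[R]_(m, n)) (a : R) M :
  f h @[h --> F] --> a -> mxcvg F G M ->
  mxcvg F (fun h => f h *: G h) (a *: M).
Proof.
move=> hf hG i j; rewrite mxE; under eq_cvg do rewrite mxE.
exact: cvgM hf (hG i j).
Qed.

Lemma mxcvgM m n p (G : T -> 'M[R]_(m, n)) (H : T -> 'M[R]_(n, p)) M N :
  mxcvg F G M -> mxcvg F H N -> mxcvg F (fun h => G h *m H h) (M *m N).
Proof.
move=> hG hH i j; rewrite mxE; under eq_cvg do rewrite mxE.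
apply: (@cvg_big _ _ +%R 0 xpredT); first exact: add_continuous.
by move=> k _; exact: cvgM (hG i k) (hH k j).
Qed.

Lemma cvg_det n (G : T -> 'M[R]_n) M :
  mxcvg F G M -> \det (G h) @[h --> F] --> \det M.
Proof.
move=> hG; rewrite /determinant.
apply: (@cvg_big _ _ +%R 0 xpredT); first exact: add_continuous.
move=> s _; apply: cvgMr.
apply: (@cvg_big R 'I_n *%R 1 xpredT _ T F); first exact: mul_continuous.
by move=> i _; exact: hG.
Qed.

(** Near an invertible limit the inverse is given by the cofactor formula, which
    is continuous in the entries. *)
Lemma mxcvg_invmx n (G : T -> 'M[R]_n) M : M \in unitmx ->
  mxcvg F G M -> mxcvg F (fun h => invmx (G h)) (invmx M).
Proof.
move=> uM hG i j; have hd := cvg_det hG.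
have dM : \det M != 0 by rewrite -unitfE.
have unear : \forall h \near F, ((\det (G h))^-1 *: \adj (G h)) i j
    = invmx (G h) i j.
  near=> h; rewrite /invmx unitmxE unitfE ifT//.
  by near: h; exact: cvgr_neq0 hd dM.
rewrite {2}/invmx uM; apply: cvg_trans (near_eq_cvg unear) _.
rewrite mxE; under eq_cvg do rewrite mxE.
apply: cvgM; first exact: cvgV.
rewrite mxE; under eq_cvg do rewrite mxE.
apply: cvgMr; apply: cvg_det => a b.
by rewrite !mxE; under eq_cvg do rewrite !mxE; exact: hG.
Unshelve. all: by end_near. Qed.

End MatrixLimits.

Section MatrixDerivative.
Variable R : realType.
Implicit Type x : R.

Definition mxderiv m n (F : R -> 'M[R]_(m, n)) x (dF : 'M[R]_(m, n)) :=
  forall i j, is_derive x 1 (fun y => F y i j) (dF i j).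

Lemma mxderiv_cst m n (M : 'M[R]_(m, n)) x : mxderiv (fun=> M) x 0.
Proof. by move=> i j; rewrite mxE; exact: is_derive_cst. Qed.

Lemma mxderivD m n (F G : R -> 'M[R]_(m, n)) x dF dG :
  mxderiv F x dF -> mxderiv G x dG ->
  mxderiv (fun y => F y + G y) x (dF + dG).
Proof.
move=> hF hG i j; rewrite mxE.
by under eq_fun do rewrite mxE; exact: is_derive_add.
Qed.

Lemma mxderivM m n p (F : R -> 'M[R]_(m, n)) (G : R -> 'M[R]_(n, p)) x dF dG :
  mxderiv F x dF -> mxderiv G x dG ->
  mxderiv (fun y => F y *m G y) x (dF *m G x + F x *m dG).
Proof.
move=> hF hG i j; rewrite !mxE -big_split/=.
under eq_fun do rewrite mxE.
by apply: is_derive_bigsum => k; exact: is_derive_mul.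
Qed.

Lemma mxderivZ m n (f : R -> R) (F : R -> 'M[R]_(m, n)) x df dF :
  is_derive x 1 f df -> mxderiv F x dF ->
  mxderiv (fun y => f y *: F y) x (df *: F x + f x *: dF).
Proof.
move=> hf hF i j; rewrite !mxE.
by under eq_fun do rewrite mxE; exact: is_derive_mul.
Qed.

Lemma mxderiv_comp m n (F : R -> 'M[R]_(m, n)) (f : R -> R) x df dF :
  mxderiv F (f x) dF -> is_derive x 1 f df ->
  mxderiv (fun y => F (f y)) x (df *: dF).
Proof.
move=> hF hf i j; rewrite mxE mulrC.
exact: (is_derive_comp (f := fun y => F y i j)).
Qed.

Lemma mxderiv_cvg m n (F : R -> 'M[R]_(m, n)) x dF :
  mxderiv F x dF -> mxcvg (nbhs x) F (F x).
Proof. by move=> hF i j; exact: is_derive_continuous (hF i j). Qed.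

(** The difference quotient of the inverse factors as
    - F(x+h)^-1 (h^-1 (F(x+h) - F(x))) F(x)^-1, so that continuity of the inverse
    is all that is needed to pass to the limit. *)
Lemma mxderiv_invmx n (F : R -> 'M[R]_n) x dF :
  F x \in unitmx -> mxderiv F x dF ->
  mxderiv (fun y => invmx (F y)) x (- (invmx (F x) *m dF *m invmx (F x))).
Proof.
move=> uF hF i j.
pose Q h := h^-1 *: (F (h + x) - F x).
have hQ : mxcvg 0^' Q dF.
  move=> a b; have [dab <-] := hF a b.
  rewrite /Q; under eq_cvg do rewrite !mxE.
  by move: dab; rewrite /derivable/derive/=; under eq_fun do rewrite scaler1.
have hs : (h + x) @[h --> (0 : R)^'] --> x.
  rewrite -[X in _ --> X]add0r; apply: cvg_within_filter.
  by apply: cvgD; [exact: cvg_id|exact: cvg_cst].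
have hFs : mxcvg 0^' (fun h => F (h + x)) (F x).
  move=> a b; apply: (cvg_comp (fun h => h + x) (fun y => F y a b) hs).
  exact: (mxderiv_cvg hF).
have hI : mxcvg 0^' (fun h => invmx (F (h + x))) (invmx (F x)).
  exact: mxcvg_invmx hFs.
have unear : \forall h \near 0^', F (h + x) \in unitmx.
  have dF0 : \det (F x) != 0 by rewrite -unitfE.
  near=> h; rewrite unitmxE unitfE; near: h.
  exact: cvgr_neq0 (cvg_det hFs) dF0.
have hl : h^-1 *: (invmx (F (h + x)) i j - invmx (F x) i j) @[h --> 0^'] -->
    (- (invmx (F x) *m dF *m invmx (F x))) i j.
  have hc : mxcvg (0 : R)^' (fun=> invmx (F x)) (invmx (F x)).
    exact: mxcvg_cst.
  have hm : mxcvg 0^' (fun h => invmx (F (h + x)) *m Q h *m invmx (F x))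
      (invmx (F x) *m dF *m invmx (F x)) by do 2?apply: mxcvgM.
  have /cvgN := hm i j; rewrite [X in _ --> X](_ : _ =
    (- (invmx (F x) *m dF *m invmx (F x))) i j); last by rewrite [in RHS]mxE.
  move=> hlim; apply: cvg_trans hlim; apply: near_eq_cvg; near=> h.
  have uh : F (h + x) \in unitmx by near: h.
  rewrite fctE /Q -scalemxAr mulmxBr mulVmx// -scalemxAl mulmxBl mul1mx mulmxK//.
  by rewrite !mxE -mulrN opprB.
split.
  by apply/cvg_ex; eexists; rewrite /=; under eq_fun do rewrite scaler1; exact: hl.
by apply: cvg_lim => //=; under eq_fun do rewrite scaler1; exact: hl.
Unshelve. all: by end_near. Qed.

Lemma mxderiv0_cst m n (F : R -> 'M[R]_(m, n)) :
  (forall x, mxderiv F x 0) -> forall x y, F x = F y.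
Proof.
move=> hF x y; apply/matrixP => i j.
apply: (is_derive_0_is_cst (f := fun z => F z i j)) => z.
by have := hF z i j; rewrite mxE.
Qed.

End MatrixDerivative.

(** * Eigenvalues of exp(sX) *)

Section ExponentialFlow.
Variables (R : realType) (n : nat).
Implicit Types (X B : 'M[R]_n) (s : R).

Lemma expmx_mxderiv X s :
  mxderiv (fun y => expmx (y *: X)) s (X *m expmx (s *: X)).
Proof. by move=> i j; exact: expmx_is_derive. Qed.

Lemma expmxN_mxderiv X s :
  mxderiv (fun y => expmx ((- y) *: X)) s (- (X *m expmx ((- s) *: X))).
Proof.
have hN : is_derive s 1 (fun y : R => - y) (- 1 : R).
  exact: is_derive_opp (is_derive_id s 1).
have := mxderiv_comp (expmx_mxderiv X (- s)) hN.
by rewrite scaleN1r.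
Qed.

Lemma expmxNK X s : expmx ((- s) *: X) *m expmx (s *: X) = 1%:M.
Proof.
pose F y := expmx ((- y) *: X) *m expmx (y *: X).
have F0 y : mxderiv F y 0.
  have := mxderivM (expmxN_mxderiv X y) (expmx_mxderiv X y).
  rewrite mulNmx mulmxA -(@expmx_comm _ _ (- y) X X)//.
  by rewrite addNr.
by have := mxderiv0_cst F0 s 0; rewrite /F oppr0 !expmx0 mulmx1.
Qed.

(** Uniqueness for the linear equation r' = r X: the product r(s) exp(-sX) has
    zero derivative. *)
Lemma expmx_flow m X (r : R -> 'M[R]_(m, n)) :
  (forall s, mxderiv r s (r s *m X)) ->
  forall s, r 0 *m expmx (s *: X) = r s.
Proof.
move=> hr s; pose F y := r y *m expmx ((- y) *: X).
have F0 y : mxderiv F y 0.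
  have := mxderivM (hr y) (expmxN_mxderiv X y).
  by rewrite mulmxN mulmxA subrr.
have := mxderiv0_cst F0 s 0; rewrite /F oppr0 expmx0 mulmx1 => <-.
by rewrite -mulmxA expmxNK mulmx1.
Qed.

(** The hypotheses say that p + iq is an eigenvector of X for a + ib; the
    conclusion is its image exp((a + ib)s) (p + iq), split into real and
    imaginary parts so that only real exponentials occur. *)
Lemma expmx_eigenplane X (p q : 'rV[R]_n) (a b s : R) :
  p *m X = a *: p - b *: q -> q *m X = b *: p + a *: q ->
  p *m expmx (s *: X) = expR (a * s) *: (cos (b * s) *: p - sin (b * s) *: q) /\
  q *m expmx (s *: X) = expR (a * s) *: (sin (b * s) *: p + cos (b * s) *: q).
Proof.
move=> hp hq.
have dlin (c y : R) : is_derive y 1 (fun z => c * z) c.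
  have := is_derive_mul (is_derive_cst c y 1) (is_derive_id y 1).
  by rewrite mul0r add0r mulr1.
have dexp (y : R) : is_derive y 1 (fun z => expR (a * z)) (expR (a * y) * a).
  exact: (is_derive_comp (f := expR)).
have dcos (y : R) : is_derive y 1 (fun z => cos (b * z)) (- sin (b * y) * b).
  exact: (is_derive_comp (f := cos)).
have dsin (y : R) : is_derive y 1 (fun z => sin (b * z)) (cos (b * y) * b).
  exact: (is_derive_comp (f := sin)).
split.
- pose r y := expR (a * y) *: (cos (b * y) *: p + (- sin (b * y)) *: q).
  have r0 : r 0 = p.
    by rewrite /r !mulr0 expR0 cos0 sin0 oppr0 scale0r addr0 !scale1r.
  rewrite -{1}r0 (expmx_flow (r := r)) => [|y].
    by rewrite /r scaleNr.
  have := mxderivZ (dexp y) (mxderivD (mxderivZ (dcos y) (mxderiv_cst p y))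
    (mxderivZ (is_derive_opp (dsin y)) (mxderiv_cst q y))).
  congr mxderiv; rewrite !scaler0 !addr0 /r.
  rewrite -scalemxAl mulmxDl -!scalemxAl hp hq.
  apply/rowP => j; rewrite !mxE; ring.
- pose r y := expR (a * y) *: (sin (b * y) *: p + cos (b * y) *: q).
  have r0 : r 0 = q.
    by rewrite /r !mulr0 expR0 cos0 sin0 scale0r add0r !scale1r.
  rewrite -{1}r0 (expmx_flow (r := r)) => // y.
  have := mxderivZ (dexp y) (mxderivD (mxderivZ (dsin y) (mxderiv_cst p y))
    (mxderivZ (dcos y) (mxderiv_cst q y))).
  congr mxderiv; rewrite !scaler0 !addr0 /r.
  rewrite -scalemxAl mulmxDl -!scalemxAl hp hq.
  apply/rowP => j; rewrite !mxE; ring.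
Qed.

End ExponentialFlow.

Section Spectrum.
Variables (R : realType) (n : nat).
Implicit Types (X B : 'M[R]_n).

Lemma Re_mulmx m (u : 'M[R[i]]_(m, n)) X :
  map_mx (@complex.Re R) (u *m map_mx (real_complex R) X) =
  map_mx (@complex.Re R) u *m X.
Proof.
apply/matrixP => i j; rewrite !mxE.
rewrite (big_morph (@complex.Re R) (id1 := 0) (op1 := +%R))//; last first.
  by move=> [? ?] [? ?].
by apply: eq_bigr => k _; rewrite !mxE; case: (u i k) => c d /=; rewrite mulr0 subr0.
Qed.

Lemma Im_mulmx m (u : 'M[R[i]]_(m, n)) X :
  map_mx (@complex.Im R) (u *m map_mx (real_complex R) X) =
  map_mx (@complex.Im R) u *m X.
Proof.
apply/matrixP => i j; rewrite !mxE.
rewrite (big_morph (@complex.Im R) (id1 := 0) (op1 := +%R))//; last first.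
  by move=> [? ?] [? ?].
by apply: eq_bigr => k _; rewrite !mxE; case: (u i k) => c d /=; rewrite mulr0 add0r.
Qed.

(** X acts on the mu-eigenspace of B because the two commute, and over the
    complex numbers this restriction has an eigenvector. *)
Lemma common_complex_eigenvector X B (mu : R) :
  comm_mx B X -> eigenvalue B mu ->
  exists z : R[i], exists u : 'rV[R[i]]_n,
    [/\ u != 0, u *m map_mx (real_complex R) X = z *: u &
        u *m map_mx (real_complex R) B = real_complex R mu *: u].
Proof.
move=> cBX; rewrite /eigenvalue => evB.
pose V := row_base (eigenspace B mu).
have VB : V *m B = mu *: V.
  by apply/eigenspaceP; rewrite eq_row_base.
have /submxP[Y VX] : (V *m X <= V)%MS.
  by rewrite stablemx_row_base comm_mx_stable_eigenspace.
have r0 : (0 < \rank (eigenspace B mu))%N by rewrite lt0n mxrank_eq0.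
have [z /eigenvalueP[w wY w0]] :=
  eigenvalue_closed (map_mx (real_complex R) Y) r0.
exists z, (w *m map_mx (real_complex R) V); split.
- by rewrite mulmx_free_eq0// row_free_map row_base_free.
- by rewrite -mulmxA -map_mxM VX map_mxM mulmxA wY scalemxAl.
- by rewrite -mulmxA -map_mxM VB map_mxZ scalemxAr.
Qed.

Lemma sin_neq0 (x : R) : - pi < x < pi -> x != 0 -> sin x != 0.
Proof.
move=> /andP[xl xr]; case: (ltgtP x 0) => // x0 _.
  by rewrite -oppr_eq0 -sinN gt_eqF// sin_gt0_pi// oppr_gt0 x0/= ltrNl.
by rewrite gt_eqF// sin_gt0_pi// x0.
Qed.

(** A real eigenvalue mu of exp(sX) is exp(s(a + ib)) for some eigenvalue a + ib
    of X. Being real, it forces sin(bs) = 0; since |bs| < pi, this leaves bs = 0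
    and mu = exp(as). *)
Lemma expmx_eigenvalue_gt0 X (s mu : R) :
  (forall z, complex_eigenvalue X z -> - pi < complex.Im z < pi) ->
  `|s| <= 1 -> eigenvalue (expmx (s *: X)) mu -> 0 < mu.
Proof.
move=> hX s1 hmu.
have cX : comm_mx (expmx (s *: X)) X by apply/esym/expmx_comm.
have [z [u [u0 uX uB]]] := common_complex_eigenvector cX hmu.
have /hX : complex_eigenvalue X z by apply/eigenvalueP; exists u.
case: z uX => a b uX /= hb.
pose p := map_mx (@complex.Re R) u; pose q := map_mx (@complex.Im R) u.
have pX : p *m X = a *: p - b *: q.
  rewrite -Re_mulmx uX; apply/rowP => j; rewrite !mxE.
  by case: (u 0 j).
have qX : q *m X = b *: p + a *: q.
  rewrite -Im_mulmx uX; apply/rowP => j; rewrite !mxE.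
  by case: (u 0 j) => c d /=; rewrite addrC.
have pB : p *m expmx (s *: X) = mu *: p.
  rewrite -Re_mulmx uB; apply/rowP => j; rewrite !mxE.
  by case: (u 0 j) => c d /=; rewrite mul0r subr0.
have qB : q *m expmx (s *: X) = mu *: q.
  rewrite -Im_mulmx uB; apply/rowP => j; rewrite !mxE.
  by case: (u 0 j) => c d /=; rewrite mul0r addr0.
have [] := expmx_eigenplane s pX qX; rewrite pB qB.
set e := expR _; set c := cos _; set d := sin _ => hp hq.
have [j pqj] : exists j, p 0 j ^+ 2 + q 0 j ^+ 2 != 0.
  have /rV0Pn[j uj] := u0; exists j; rewrite paddr_eq0 ?sqr_ge0// !sqrf_eq0 !mxE.
  by move: uj; rewrite eq_complex.
have hpj : mu * p 0 j = e * (c * p 0 j - d * q 0 j).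
  by have /rowP/(_ j) := hp; rewrite !mxE.
have hqj : mu * q 0 j = e * (d * p 0 j + c * q 0 j).
  by have /rowP/(_ j) := hq; rewrite !mxE.
(* Contract the two coordinate equations with (p, q) and with (q, - p): the
   first isolates the real part of exp(s(a + ib)), the second its imaginary
   part. *)
have hmuc : mu = e * c.
  apply: (mulIf pqj); rewrite mulrDr !expr2 !mulrA hpj hqj; ring.
have hd : d = 0.
  have : e * d * (p 0 j ^+ 2 + q 0 j ^+ 2) = 0.
    transitivity (mu * q 0 j * p 0 j - mu * p 0 j * q 0 j); last by ring.
    rewrite hpj hqj; ring.
  by move/eqP; rewrite !mulf_eq0 (negbTE pqj) orbF gt_eqF ?expR_gt0//= => /eqP.
have bs0 : b * s = 0.
  apply/eqP; apply/negPn/negP => bs; move: hd; rewrite /d; apply/eqP.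
  apply: sin_neq0 bs; rewrite -ltr_norml normrM.
  apply: (@le_lt_trans _ _ `|b|); last by rewrite ltr_norml.
  by rewrite ler_piMr.
by rewrite hmuc /c bs0 cos0 mulr1 expR_gt0.
Qed.

(** A kernel vector would be an eigenvector of exp(sX) for the nonpositive value
    - (1 - t) / t. *)
Lemma homotopy_unitmx X (s t : R) :
  (forall z, complex_eigenvalue X z -> - pi < complex.Im z < pi) ->
  `|s| <= 1 -> 0 <= t <= 1 ->
  1%:M + t *: (expmx (s *: X) - 1%:M) \in unitmx.
Proof.
move=> hX s1 /andP[t0 t1].
have [->|tn0] := eqVneq t 0; first by rewrite scale0r addr0 unitmx1.
have tp : 0 < t by rewrite lt_neqAle eq_sym tn0.
rewrite -row_free_unit -kermx_eq0; apply/negPn/negP => /rowV0Pn[v].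
rewrite sub_kermx => /eqP; rewrite mulmxDr mulmx1 -scalemxAr mulmxBr mulmx1 => hv v0.
have : eigenvalue (expmx (s *: X)) (- ((1 - t) / t)).
  apply/eigenvalueP; exists v => //; apply: (scalerI tn0); rewrite scalerA.
  have -> : t * - ((1 - t) / t) = t - 1 by field.
  apply/rowP => j; have /rowP/(_ j) := hv; rewrite !mxE => h.
  lra.
move/(expmx_eigenvalue_gt0 hX s1); rewrite oppr_gt0 ltNge divr_ge0// subr_ge0//.
Qed.

End Spectrum.

(** * The fundamental theorem of calculus and monotonicity *)

Section Integrals.
Variable R : realType.
Local Notation mu := (@lebesgue_measure R).
Implicit Types (f F df : R -> R) (a b x t : R).

Lemma within_continuous_itv f a b :
  (forall x, a <= x <= b -> {for x, continuous f}) ->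
  {within `[a, b], continuous f}.
Proof.
move=> hf; apply: continuous_in_subspaceT => x; rewrite inE/= in_itv/=.
exact: hf.
Qed.

Lemma Rintegral_FTC f F a b : a <= b ->
  (forall x, a <= x <= b -> {for x, continuous f}) ->
  (forall x, a <= x <= b -> is_derive x 1 F (f x)) ->
  Rintegral mu `[a, b] f = F b - F a.
Proof.
move=> ab cf dF; case: ltgtP ab => // [ab|<-] _; last first.
  by rewrite set_itv1 Rintegral_set1 subrr.
have cF x : a <= x <= b -> {for x, continuous F}.
  by move=> xab; exact: is_derive_continuous (dF x xab).
rewrite /Rintegral (@continuous_FTC2 _ f F)//.
- exact: within_continuous_itv.
- split.
  + move=> x; rewrite in_itv/= => /andP[/ltW ax /ltW xb].
    by have [] := dF x; rewrite ?ax.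
  + by apply: cvg_at_right_filter; apply: cF; rewrite lexx ltW.
  + by apply: cvg_at_left_filter; apply: cF; rewrite lexx ltW.
- move=> x; rewrite in_itv/= => /andP[/ltW ax /ltW xb].
  by rewrite derive1E; apply: derive_val; apply: dF; rewrite ax.
Qed.

Lemma derive_le0_le f df a b : a <= b ->
  (forall x, a <= x <= b -> is_derive x 1 f (df x)) ->
  (forall x, a <= x <= b -> df x <= 0) -> f b <= f a.
Proof.
move=> ab dfx df0.
have dfoo x : x \in `]a, b[ -> is_derive x 1 f (df x).
  by rewrite in_itv/= => /andP[/ltW ax /ltW xb]; apply: dfx; rewrite ax.
have cf : {within `[a, b], continuous f}.
  by apply: within_continuous_itv => x xab; exact: is_derive_continuous (dfx x xab).
have [c] := MVT_segment ab dfoo cf.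
rewrite in_itv/= => cab fba.
by rewrite -subr_le0 fba mulr_le0_ge0 ?df0 ?subr_ge0.
Qed.

Lemma derive_eq0_eq f df a b : a <= b ->
  (forall x, a <= x <= b -> is_derive x 1 f (df x)) ->
  (forall x, a <= x <= b -> df x = 0) -> f b = f a.
Proof.
move=> ab dfx df0; apply/eqP; rewrite eq_le; apply/andP; split.
  by apply: (derive_le0_le ab dfx) => x /df0 ->.
rewrite -lerN2; apply: (derive_le0_le (f := fun x => - f x)
  (df := fun x => - df x) ab) => x xab; first exact/is_derive_opp/dfx.
by rewrite df0// oppr0.
Qed.

End Integrals.

(** * The integral representation of the principal logarithm *)

Section Resolvent.
Variables (R : realType) (n : nat).
Local Notation mu := (@lebesgue_measure R).
Implicit Types (E X : 'M[R]_n) (t x : R).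

Lemma resolvent_mxderiv E t : 1%:M + t *: E \in unitmx ->
  mxderiv (fun y => invmx (1%:M + y *: E)) t
    (- (invmx (1%:M + t *: E) *m E *m invmx (1%:M + t *: E))).
Proof.
move=> ut.
have := mxderivD (mxderiv_cst 1%:M t)
  (mxderivZ (is_derive_id t 1) (mxderiv_cst E t)).
by rewrite scaler0 addr0 scale1r add0r => /(mxderiv_invmx ut).
Qed.

(** The two-sided derivative at the end points 0 and 1 calls for an integrand
    defined and continuous beyond them; the resolvent is extended by constants. *)
Lemma resolvent_primitive E :
  (forall t, 0 <= t <= 1 -> 1%:M + t *: E \in unitmx) ->
  exists Phi : R -> 'M[R]_n,
    forall t, 0 <= t <= 1 -> mxderiv Phi t (invmx (1%:M + t *: E)).
Proof.
move=> uE; pose clamp t := Num.max 0 (Num.min t 1) : R.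
have clamp01 t : 0 <= clamp t <= 1.
  by rewrite /clamp le_max lexx/= ge_max ler01/= ge_min lexx orbT.
have clampK t : 0 <= t <= 1 -> clamp t = t.
  by case/andP=> t0 t1; rewrite /clamp min_l// max_r.
have cclamp : continuous clamp.
  move=> t; apply: (@continuous_max R _ (cst 0) (fun t => Num.min t 1)).
    exact: cvg_cst.
  apply: (@continuous_min R _ id (cst 1)); first exact: cvg_id.
  exact: cvg_cst.
pose f i j t := invmx (1%:M + clamp t *: E) i j.
have cf i j : continuous (f i j).
  move=> t; apply: (@continuous_comp _ _ _ clamp
    (fun y => invmx (1%:M + y *: E) i j)); first exact: cclamp.
  by apply: is_derive_continuous; apply: resolvent_mxderiv; exact: uE.
exists (fun t => \matrix_(i, j) Rintegral mu `[-1, t] (f i j)).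
move=> t t01 i j; under eq_fun do rewrite mxE.
have fi : mu.-integrable `[-1, 2] (EFin \o f i j).
  apply: continuous_compact_integrable; first exact: segment_compact.
  exact: continuous_subspaceT.
have [t0 t1] := andP t01.
have t2 : t < 2 by lra.
have tN1 : -1 < t by lra.
have [dF Fe] := continuous_FTC1_closed t2 fi tN1 (cf i j t).
apply: DeriveDef => //.
by rewrite -derive1E Fe /f clampK.
Qed.

Lemma invmx_comm (P Q : 'M[R]_n) : Q \in unitmx ->
  comm_mx P Q -> comm_mx P (invmx Q).
Proof.
move=> uQ cPQ; rewrite /comm_mx -[LHS]mul1mx -(mulVmx uQ) -mulmxA.
by rewrite [Q *m _]mulmxA -cPQ -[P *m Q *m _]mulmxA mulmxV// mulmx1.
Qed.

(** Suppose that D is the derivative of E in a parameter s. The first formula is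
    then the derivative of E S in s, the second that of t D S in t; their equality
    says that the form E S dt + t D S ds is closed. Both follow from
    t E S = S (t E) = 1 - S and from the fact that D commutes with S. *)
Lemma resolvent_closed_form (D E : 'M[R]_n) t : comm_mx D E ->
  1%:M + t *: E \in unitmx -> let S := invmx (1%:M + t *: E) in
  D *m S + E *m - (S *m (t *: D) *m S) = D *m S *m S /\
  D *m S + t *: (D *m - (S *m E *m S)) = D *m S *m S.
Proof.
move=> cDE uC S.
have ES : t *: E *m S = 1%:M - S.
  by rewrite -[t *: E](addKr 1%:M) mulmxDl mulmxV// mulNmx mul1mx addrC.
have SE : S *m (t *: E) = 1%:M - S.
  by rewrite -[t *: E](addKr 1%:M) mulmxDr mulVmx// mulmxN mulmx1 addrC.
have cDS : D *m S = S *m D.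
  apply: invmx_comm => //; apply: comm_mxD; first exact: comm_mx1.
  by rewrite /comm_mx -scalemxAr -scalemxAl cDE.
split.
  rewrite mulmxN -[S *m (t *: D)]scalemxAr -scalemxAl -scalemxAr !mulmxA !scalemxAl.
  by rewrite ES mulmxBl mulmxBl mul1mx -cDS opprB addrC subrK.
rewrite mulmxN scalerN scalemxAr scalemxAl scalemxAr SE mulmxBl mul1mx mulmxBr.
by rewrite opprB addrC subrK mulmxA.
Qed.

(** Deform A to the identity through B = exp(sX). The matrix
    L(s) = int_0^1 (B - 1) (1 + t (B - 1))^-1 dt vanishes at s = 0, and
    differentiation under the integral sign together with
    [resolvent_closed_form] gives L'(s) = X B B^-1 = X, whence L(1) = X. The
    strip condition on the eigenvalues of X is what keeps the resolvent defined
    on the whole square. *)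
Lemma log_integral X A : is_principal_log A X ->
  (forall t, 0 <= t <= 1 -> 1%:M + t *: (A - 1%:M) \in unitmx) /\
  forall i j, X i j = Rintegral mu `[0, 1]
    (fun t => ((A - 1%:M) *m invmx (1%:M + t *: (A - 1%:M))) i j).
Proof.
move=> [eXA hX].
(* Running through s = sin x makes the family defined and admissible for every
   real x, so that differentiation under the integral sign applies on an open
   interval around [0, pi / 2]. *)
pose B x := expmx (sin x *: X).
pose C x t := 1%:M + t *: (B x - 1%:M).
have uC x t : 0 <= t <= 1 -> C x t \in unitmx.
  by move=> t01; apply: homotopy_unitmx => //; rewrite ler_norml sin_geN1 sin_le1.
have Bpi : B (pi / 2) = A by rewrite /B sin_pihalf scale1r.
split=> [t t01|i j]; first by rewrite -Bpi; exact: uC.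
pose D x := cos x *: (X *m B x).
pose G x t := (B x - 1%:M) *m invmx (C x t).
pose K x t := t *: (D x *m invmx (C x t)).
pose H x t := D x *m invmx (C x t) *m invmx (C x t).
have cXB x : comm_mx X (B x) by exact: expmx_comm.
have cDB x : comm_mx (D x) (B x - 1%:M).
  apply: comm_mxB; last exact: comm_mx1.
  by rewrite /comm_mx /D -scalemxAl -scalemxAr [in RHS]mulmxA -cXB.
have dB x : mxderiv (fun y => B y - 1%:M) x (D x).
  have := mxderivD (mxderiv_comp (expmx_mxderiv X (sin x)) (is_derive_sin x))
    (mxderiv_cst (- 1%:M) x).
  by rewrite addr0.
have dG x t : 0 <= t <= 1 -> mxderiv (fun y => G y t) x (H x t).
  move=> t01.
  have dC : mxderiv (fun y => C y t) x (t *: D x).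
    have := mxderivD (mxderiv_cst 1%:M x)
      (mxderivZ (is_derive_cst t x 1) (dB x)).
    by rewrite scale0r !add0r.
  have := mxderivM (dB x) (mxderiv_invmx (F := fun y => C y t) (uC x t t01) dC).
  by rewrite (resolvent_closed_form (cDB x) (uC x t t01)).1.
have dK x t : 0 <= t <= 1 -> mxderiv (K x) t (H x t).
  move=> t01; have := mxderivZ (is_derive_id t 1)
    (mxderivM (mxderiv_cst (D x) t) (resolvent_mxderiv (uC x t t01))).
  rewrite mul0mx add0r scale1r.
  by rewrite (resolvent_closed_form (cDB x) (uC x t t01)).2.
have cB x : mxcvg (nbhs x) B (B x).
  exact: mxderiv_cvg (mxderiv_comp (expmx_mxderiv X (sin x)) (is_derive_sin x)).
have cH x t : 0 <= t <= 1 ->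
    {for (x, t), continuous (fun z : R * R => H z.1 z.2 i j)}.
  move=> t01.
  have c1 : (z.1 : R) @[z --> (x, t)] --> x by exact: cvg_fst.
  have c2 : (z.2 : R) @[z --> (x, t)] --> t by exact: cvg_snd.
  have cB1 : mxcvg (nbhs (x, t)) (fun z => B z.1) (B x).
    move=> a b; apply: (cvg_comp (fun z : R * R => z.1) (fun y => B y a b) c1).
    exact: cB.
  have ccos : cos z.1 @[z --> (x, t)] --> cos x.
    apply: (cvg_comp (fun z : R * R => z.1) cos c1); exact: continuous_cos.
  have cI : mxcvg (nbhs (x, t)) (fun z => invmx (C z.1 z.2)) (invmx (C x t)).
    apply: mxcvg_invmx; first exact: uC.
    apply: mxcvgD; first exact: mxcvg_cst.
    apply: mxcvgZ => //; apply: mxcvgD => //; exact: mxcvg_cst.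
  apply: mxcvgM => //; apply: mxcvgM => //; apply: mxcvgZ => //.
  by apply: mxcvgM => //; exact: mxcvg_cst.
(* The dominating function is a constant, by compactness of the rectangle. *)
have [M M0 hM] : exists2 M, 0 <= M & forall x t,
    -1 <= x <= pi -> 0 <= t <= 1 -> `|H x t i j| <= M.
  have cS : compact (`[-1, pi] `*` `[0, 1] : set (R * R)).
    by apply: compact_setX; exact: segment_compact.
  have : {within `[-1, pi] `*` `[0, 1], continuous (fun z : R * R => H z.1 z.2 i j)}.
    apply: continuous_in_subspaceT => -[x t]; rewrite inE/= => -[_].
    by rewrite /= ?in_itv/=; exact: cH.
  move/continuous_compact/(_ cS)/compact_bounded/pinfty_ex_gt0 => [M M0 hM].
  exists M; first exact: ltW.
  by move=> x t xI tI; apply: hM; exists (x, t).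
pose f x t := G x t i j.
have cG x t : 0 <= t <= 1 -> {for t, continuous (f x)}.
  move=> t01; apply: is_derive_continuous.
  exact: (mxderivM (mxderiv_cst _ t) (resolvent_mxderiv (uC x t t01))).
pose L x := Rintegral mu `[0, 1] (f x).
have dL x : -1 < x < pi -> is_derive x 1 L (cos x * X i j).
  move=> xI.
  have d1 y t : 0 <= t <= 1 -> partial1of2 f y t = H y t i j.
    by move=> t01; rewrite partial1of2E; apply: derive_val; exact: dG.
  have Ix : `]-1, pi[%classic x by rewrite /= in_itv.
  have intf y : `]-1, pi[%classic y -> mu.-integrable `[0, 1] (EFin \o f y).
    move=> _; apply: continuous_compact_integrable; first exact: segment_compact.
    by apply: within_continuous_itv => t; exact: cG.
  have derf y t : `]-1, pi[%classic y -> `[0, 1]%classic t -> derivable (f ^~ t) y 1.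
    by move=> _; rewrite /= in_itv/= => t01; have [] := dG y t t01 i j.
  have ub y t : `]-1, pi[%classic y -> `[0, 1]%classic t ->
      `|partial1of2 f y t| <= cst M t.
    rewrite /= !in_itv/= => /andP[/ltW y1 /ltW y2] t01.
    by rewrite d1//; apply: hM; rewrite ?y1.
  have intM : mu.-integrable `[0, 1] (EFin \o (cst M : R -> R)).
    apply: continuous_compact_integrable; first exact: segment_compact.
    by apply: continuous_subspaceT => ?; exact: cvg_cst.
  have dLx := @derivable_under_integral R _ _ mu f _ (measurable_itv `[0, 1]) _ _ _
    Ix intf derf _ (fun=> M0) intM ub.
  have Le := @differentiation_under_integral R _ _ mu f _ (measurable_itv `[0, 1]) _ _ _
    Ix intf derf _ (fun=> M0) intM ub.
  apply: DeriveDef => //; rewrite -derive1E Le.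
  transitivity (Rintegral mu `[0, 1] (fun t => H x t i j)).
    apply: eq_Rintegral => t; rewrite inE/= in_itv/= => t01.
    exact: d1.
  have cHx t : 0 <= t <= 1 -> {for t, continuous (fun t => H x t i j)}.
    move=> t01; apply: (@continuous_comp _ _ _ (fun t => (x, t))
      (fun z : R * R => H z.1 z.2 i j)); last exact: cH.
    by apply: (@cvg_pair _ _ _ (nbhs t) (nbhs x) (nbhs t) _ _ _ (fun=> x) id);
      [exact: cvg_cst|exact: cvg_id].
  have dKx t : 0 <= t <= 1 -> is_derive t 1 (fun t => K x t i j) (H x t i j).
    by move=> t01; exact: dK.
  have C1 : C x 1 = B x by rewrite /C scale1r addrC subrK.
  have uB : B x \in unitmx by rewrite -C1 uC// ler01 lexx.
  rewrite (Rintegral_FTC ler01 cHx dKx).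
  by rewrite /K scale0r scale1r C1 /D -scalemxAl mulmxK// !mxE subr0.
have pi2 : 0 <= pi / 2 :> R by rewrite divr_ge0 ?pi_ge0.
have := derive_eq0_eq (f := fun x => L x - sin x * X i j) (df := fun=> 0) pi2.
have L0 : L 0 = 0.
  rewrite /L /f /G /B sin0 expmx0 subrr.
  under eq_Rintegral do rewrite mul0mx mxE.
  by rewrite Rintegral_cst// mul0r.
rewrite L0 sin0 sin_pihalf mul0r mul1r subr0 => h.
have {h} := h _ (fun _ _ => erefl).
rewrite /L /f /G /C Bpi => h; apply/esym/eqP; rewrite -subr_eq0; apply/eqP; apply: h.
move=> x /andP[x0 xp].
have xI : -1 < x < pi.
  have := pi_gt0 R; lra.
have := is_derive_add (dL x xI) (is_derive_opp (is_derive_mul (is_derive_sin x)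
  (is_derive_cst (X i j) x 1))).
by rewrite mulr0 addr0 subrr.
Qed.

End Resolvent.

(** * The spectral norm *)

Section SpectralNorm.
Variables (R : realType) (n : nat).
Implicit Types (u v w : 'cV[R]_n) (M : 'M[R]_n) (c : R).

Definition dot u v : R := \sum_i u i 0 * v i 0.

Lemma norm2_ge0 v : 0 <= norm2 v.
Proof. exact: sqrtr_ge0. Qed.

Lemma norm2_sqr v : norm2 v ^+ 2 = dot v v.
Proof.
rewrite sqr_sqrtr; first by apply: eq_bigr => i _; rewrite expr2.
by apply: sumr_ge0 => i _; exact: sqr_ge0.
Qed.

Lemma norm2_eq0 v : norm2 v = 0 -> v = 0.
Proof.
move=> v0; apply/matrixP => i j; rewrite ord1 mxE {j}.
have := norm2_sqr v; rewrite v0 expr0n/= => /esym/eqP.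
rewrite psumr_eq0 => [|k _]; last by rewrite -expr2 sqr_ge0.
by move=> /allP/(_ i); rewrite mem_index_enum -expr2 sqrf_eq0 => /(_ isT)/eqP.
Qed.

Lemma norm2_0 : norm2 (0 : 'cV[R]_n) = 0.
Proof. by rewrite /norm2 big1 ?sqrtr0// => i _; rewrite mxE expr0n. Qed.

Lemma norm2Z c v : norm2 (c *: v) = `|c| * norm2 v.
Proof.
rewrite -sqrtr_sqr -sqrtrM ?sqr_ge0// mulr_sumr; congr Num.sqrt.
by apply: eq_bigr => i _; rewrite mxE exprMn.
Qed.

Lemma dotDr u v w : dot u (v + w) = dot u v + dot u w.
Proof. by rewrite -big_split; apply: eq_bigr => i _; rewrite mxE mulrDr. Qed.

Lemma dotZr c u v : dot u (c *: v) = c * dot u v.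
Proof. by rewrite mulr_sumr; apply: eq_bigr => i _; rewrite mxE mulrCA. Qed.

Lemma dotBr u v w : dot u (v - w) = dot u v - dot u w.
Proof. by rewrite dotDr -scaleN1r dotZr mulN1r. Qed.

Lemma dotC u v : dot u v = dot v u.
Proof. by apply: eq_bigr => i _; rewrite mulrC. Qed.

(** Cauchy-Schwarz, from the square of |v| u - |u| v. *)
Lemma dot_le_norm2 u v : dot u v <= norm2 u * norm2 v.
Proof.
have [/norm2_eq0->|u0] := eqVneq (norm2 u) 0.
  by rewrite dotC /dot big1 ?mulr_ge0 ?norm2_ge0// => i _; rewrite mxE mulr0.
have [/norm2_eq0->|v0] := eqVneq (norm2 v) 0.
  by rewrite /dot big1 ?mulr_ge0 ?norm2_ge0// => i _; rewrite mxE mulr0.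
set a := norm2 u in u0 *; set b := norm2 v in v0 *.
have ab : 0 < a * b.
  by rewrite mulr_gt0// lt_neqAle norm2_ge0 eq_sym ?u0 ?v0.
have : 0 <= dot (b *: u - a *: v) (b *: u - a *: v) by rewrite -norm2_sqr sqr_ge0.
rewrite -scaleNr !dotDr !dotZr !(dotC (_ + _)) !dotDr !dotZr -!norm2_sqr.
rewrite (dotC v u) -/a -/b.
by move=> h; rewrite -(ler_pM2l ab); nra.
Qed.

Lemma norm2D u v : norm2 (u + v) <= norm2 u + norm2 v.
Proof.
rewrite -(@ler_pXn2r _ 2)// ?nnegrE ?addr_ge0 ?norm2_ge0//.
rewrite norm2_sqr dotDr !(dotC (_ + _)) !dotDr -!norm2_sqr (dotC v u).
have := dot_le_norm2 u v; nra.
Qed.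

Lemma norm2B u v : norm2 u - norm2 v <= norm2 (u + v).
Proof.
have := norm2D (u + v) (- v); rewrite addrK -scaleN1r norm2Z normrN1 mul1r.
by rewrite lerBlDr.
Qed.

(** Testing against unit vectors reduces a bound on a vector-valued integral to a
    monotonicity statement about real functions. *)
Lemma norm2_le_dot w c : 0 <= c ->
  (forall u, norm2 u = 1 -> dot u w <= c) -> norm2 w <= c.
Proof.
move=> c0 hw; have [->//|w0] := eqVneq (norm2 w) 0.
have := hw ((norm2 w)^-1 *: w).
rewrite norm2Z ger0_norm ?invr_ge0 ?norm2_ge0// mulVf// => /(_ erefl).
by rewrite dotC dotZr -norm2_sqr expr2 mulrA mulVf// mul1r.
Qed.

(** The Frobenius norm; it bounds the set whose supremum is [specnorm M]. *)
Let frob M := Num.sqrt (\sum_i \sum_j M i j ^+ 2).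

Let norm2_mulmx_frob M v : norm2 v = 1 -> norm2 (M *m v) <= frob M.
Proof.
move=> v1; apply: ler_wsqrtr; apply: ler_sum => i _.
have -> : (M *m v) i 0 = dot (row i M)^T v.
  by rewrite mxE; apply: eq_bigr => j _; rewrite !mxE.
have <- : norm2 (row i M)^T ^+ 2 = \sum_j M i j ^+ 2.
  by rewrite norm2_sqr; apply: eq_bigr => j _; rewrite !mxE expr2.
have h1 := dot_le_norm2 (row i M)^T v.
have h2 := dot_le_norm2 (row i M)^T (- v).
move: h2; rewrite -scaleN1r dotZr norm2Z normrN1 mul1r mulN1r.
move: h1; rewrite v1 mulr1 => h1 h2; nra.
Qed.

Lemma norm2_mulmx M v : norm2 (M *m v) <= specnorm M * norm2 v.
Proof.
have [v0|v0] := eqVneq (norm2 v) 0.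
  by rewrite v0 mulr0 (norm2_eq0 v0) mulmx0 norm2_0.
have vp : 0 < norm2 v by rewrite lt_neqAle eq_sym v0 norm2_ge0.
rewrite -ler_pdivrMr//.
have -> : norm2 (M *m v) / norm2 v = norm2 (M *m ((norm2 v)^-1 *: v)).
  by rewrite -scalemxAr norm2Z ger0_norm ?invr_ge0 ?norm2_ge0// mulrC.
apply: ub_le_sup.
  by exists (frob M) => _ /= [w w1 <-]; exact: norm2_mulmx_frob.
exists ((norm2 v)^-1 *: v) => //=.
by rewrite norm2Z ger0_norm ?invr_ge0 ?norm2_ge0// mulVf.
Qed.

Lemma specnorm_ge0 M : 0 <= specnorm M.
Proof.
rewrite /specnorm; set S := (X in sup X).
have [->|/set0P[_ [v v1 _]]] := eqVneq S set0; first by rewrite sup0.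
by have := norm2_mulmx M v; rewrite v1 mulr1; apply: le_trans; exact: norm2_ge0.
Qed.

Lemma specnorm_le M c : 0 <= c ->
  (forall v, norm2 v = 1 -> norm2 (M *m v) <= c) -> specnorm M <= c.
Proof.
move=> c0 hM; rewrite /specnorm; set S := (X in sup X).
have [->|/set0P S0] := eqVneq S set0; first by rewrite sup0.
by apply: ge_sup => // _ [v v1 <-]; exact: hM.
Qed.

Lemma specnorm_le_dot M c : 0 <= c ->
  (forall u v, norm2 u = 1 -> norm2 v = 1 -> dot u (M *m v) <= c) ->
  specnorm M <= c.
Proof.
move=> c0 hM; apply: specnorm_le => // v v1.
by apply: norm2_le_dot => // u u1; exact: hM.
Qed.

Lemma specnorm_gt0 M : M <> 0 -> 0 < specnorm M.
Proof.
move=> M0; rewrite ltNge; apply/negP => M_le0; apply: M0.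
apply/matrixP => i j; rewrite mxE.
pose e : 'cV[R]_n := \col_k (k == j)%:R.
have Me : norm2 (M *m e) = 0.
  apply/eqP; rewrite eq_le norm2_ge0 andbT; apply: le_trans (norm2_mulmx _ _) _.
  by rewrite mulr_le0_ge0 ?norm2_ge0.
have /matrixP/(_ i 0) := norm2_eq0 Me; rewrite !mxE (bigD1 j)//= big1 => [|k kj].
  by rewrite mxE eqxx mulr1 addr0.
by rewrite mxE (negbTE kj) mulr0.
Qed.

Lemma specnorm0 : specnorm (0 : 'M[R]_n) = 0.
Proof.
apply/eqP; rewrite eq_le specnorm_ge0 andbT.
by apply: specnorm_le => // v _; rewrite mul0mx norm2_0.
Qed.

End SpectralNorm.

(** * The double exponential substitution *)

Section DoubleExponential.
Variable R : realType.
Implicit Types (x y a : R).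

Lemma sinh_asinh y : sinh (asinh y) = y.
Proof.
rewrite /asinh; apply: (@getPex _ [set x | sinh x = y]).
pose q := y + Num.sqrt (y ^+ 2 + 1).
have s2 : Num.sqrt (y ^+ 2 + 1) ^+ 2 = y ^+ 2 + 1.
  by rewrite sqr_sqrtr// addr_ge0// sqr_ge0.
have q0 : 0 < q.
  have s0 := sqrtr_ge0 (y ^+ 2 + 1).
  rewrite /q; nra.
(* exp x = q is the positive root of q - 1 / q = 2 y. *)
exists (ln q); rewrite /= /sinh expRN lnK//.
apply: (mulIf (lt0r_neq0 q0)); rewrite mulrAC mulrBl mulVf ?lt0r_neq0//.
by rewrite /q; nra.
Qed.

Lemma tanh_atanh y : -1 < y < 1 -> tanh (atanh y) = y.
Proof.
move=> /andP[y1 y2]; rewrite /atanh; apply: (@getPex _ [set x | tanh x = y]).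
have w0 : 0 < (1 + y) / (1 - y) by rewrite divr_gt0//; lra.
exists (ln ((1 + y) / (1 - y)) / 2); rewrite /= /tanh /sinh /cosh expRN.
set p := expR _.
have p0 : 0 < p by exact: expR_gt0.
have pp : p * p = (1 + y) / (1 - y) by rewrite -expRD -splitr lnK.
have ny : 1 - y != 0 by rewrite subr_eq0 gt_eqF.
have pn : p != 0 by rewrite gt_eqF.
have ppn : p * p + 1 != 0 by rewrite gt_eqF// addr_gt0// mulr_gt0.
have -> : (p - p^-1) / 2 / ((p + p^-1) / 2) = (p * p - 1) / (p * p + 1).
  have p2 : p + p^-1 != 0 by rewrite gt_eqF// addr_gt0// invr_gt0.
  by field; rewrite ppn pn.
by apply: (mulIf ppn); rewrite divfK// pp; field.
Qed.

Lemma cosh_gt0 x : 0 < cosh x.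
Proof. by rewrite divr_gt0// addr_gt0// expR_gt0. Qed.

Lemma cosh_sinh x : cosh x ^+ 2 - sinh x ^+ 2 = 1.
Proof.
rewrite /cosh /sinh expRN.
have : expR x != 0 by rewrite gt_eqF// expR_gt0.
by move=> e0; field.
Qed.

Let is_derive_expRN x : is_derive x 1 (fun y => expR (- y)) (- expR (- x)).
Proof.
have hN : is_derive x 1 (fun y : R => - y) (- 1 : R).
  exact: is_derive_opp (is_derive_id x 1).
have := is_derive_comp (is_derive_expR (- x)) hN.
by rewrite mulrN1.
Qed.

Lemma is_derive_sinh x : is_derive x 1 (@sinh R) (cosh x).
Proof.
have := is_derive_mul (is_derive_add (is_derive_expR x)
  (is_derive_opp (is_derive_expRN x))) (is_derive_cst (2^-1 : R) x 1).
by rewrite opprK mulr0 addr0.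
Qed.

Lemma is_derive_cosh x : is_derive x 1 (@cosh R) (sinh x).
Proof.
have := is_derive_mul (is_derive_add (is_derive_expR x)
  (is_derive_expRN x)) (is_derive_cst (2^-1 : R) x 1).
by rewrite mulr0 addr0.
Qed.

Lemma is_derive_tanh x : is_derive x 1 (@tanh R) (sech x ^+ 2).
Proof.
have c0 : cosh x != 0 by rewrite gt_eqF// cosh_gt0.
have dV : is_derive x 1 (fun y : R => (cosh y)^-1) (- (sinh x / cosh x ^+ 2)).
  apply: is_derive_eq (is_deriveV c0 (is_derive_cosh x)) _.
  by rewrite /GRing.scale/= mulNr mulrC.
have := is_derive_mul (is_derive_sinh x) dV.
congr is_derive; rewrite /sech /GRing.scale/= -[RHS]mul1r -(cosh_sinh x).
by field.
Qed.

(** The double exponential change of variable, onto ]0, 1[. *)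
Definition de_subst x : R := (1 + tanh (sinh x)) / 2.

Lemma is_derive_de_subst x :
  is_derive x 1 de_subst (cosh x * sech (sinh x) ^+ 2 / 2).
Proof.
have := is_derive_mul (is_derive_add (is_derive_cst (1 : R) x 1)
  (is_derive_comp (is_derive_tanh (sinh x)) (is_derive_sinh x)))
  (is_derive_cst (2^-1 : R) x 1).
by rewrite mulr0 addr0 add0r [sech _ ^+ 2 * _]mulrC.
Qed.

Lemma de_subst_itv x : 0 < de_subst x < 1.
Proof.
rewrite /de_subst /tanh.
have e1 := expR_gt0 (sinh x); have e2 := expR_gt0 (- sinh x).
have -> : (1 + sinh (sinh x) / cosh (sinh x)) / 2 =
    expR (sinh x) / (expR (sinh x) + expR (- sinh x)).
  rewrite {1}/sinh /cosh; field.
  by rewrite gt_eqF// addr_gt0.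
by rewrite divr_gt0 ?addr_gt0//= ltr_pdivrMr ?addr_gt0// mul1r ltrDl.
Qed.

Lemma de_subst_asinh_atanh a : 0 < a < 1 ->
  de_subst (asinh (atanh (2 * a - 1))) = a.
Proof.
move=> /andP[a0 a1]; rewrite /de_subst sinh_asinh tanh_atanh; first by field.
by apply/andP; split; lra.
Qed.

Lemma continuous_cosh : continuous (@cosh R).
Proof. by move=> x; exact: is_derive_continuous (is_derive_cosh x). Qed.

Lemma oriented_integralE (f F : R -> R) l r :
  continuous f -> (forall x, is_derive x 1 F (f x)) ->
  oriented_integral l r f = F r - F l.
Proof.
move=> cf dF; rewrite /oriented_integral; have [lr|/ltW rl] := leP l r.
  by apply: Rintegral_FTC => // x _; exact: cf.
by rewrite (Rintegral_FTC (f := f) (F := F) rl) ?opprB// => x _; exact: cf.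
Qed.

(** With t = [de_subst x], the bracket of F_DE is 2 (1 + t (A - 1)) and the scalar
    factor is 2 dt/dx, so F_DE dx is the resolvent times dt. *)
Lemma integral_F_DE n (A : 'M[R]_n) (Phi : R -> 'M[R]_n) l r :
  (forall t, 0 <= t <= 1 -> 1%:M + t *: (A - 1%:M) \in unitmx) ->
  (forall t, 0 <= t <= 1 -> mxderiv Phi t (invmx (1%:M + t *: (A - 1%:M)))) ->
  integral_mx l r (F_DE A) = Phi (de_subst r) - Phi (de_subst l).
Proof.
move=> uA dPhi; apply/matrixP => i j; rewrite !mxE.
have l01 x : 0 <= de_subst x <= 1.
  by have /andP[/ltW -> /ltW ->] := de_subst_itv x.
have FE x : F_DE A x = (cosh x * sech (sinh x) ^+ 2 / 2) *:
    invmx (1%:M + de_subst x *: (A - 1%:M)).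
  rewrite /F_DE.
  have -> : (1 + tanh (sinh x)) *: (A - 1%:M) + 2 *: 1%:M =
      2 *: (1%:M + de_subst x *: (A - 1%:M)).
    rewrite [RHS]scalerDr [in RHS]scalerA addrC; congr (_ + _ *: _).
    by rewrite /de_subst mulrC divfK.
  by rewrite invmxZ ?unitmxZ ?unitfE// ?uA// scalerA.
apply: (oriented_integralE (F := fun x => Phi (de_subst x) i j)) => x.
  have -> : (fun x => F_DE A x i j) = (fun x =>
     (cosh x * sech (sinh x) ^+ 2 / 2) *
      invmx (1%:M + de_subst x *: (A - 1%:M)) i j).
    by apply/funext => y; rewrite FE mxE.
  apply: cvgM; last first.
    apply: (cvg_comp de_subst (fun y => invmx (1%:M + y *: (A - 1%:M)) i j)
      (is_derive_continuous (is_derive_de_subst x))).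
    exact: (mxderiv_cvg (resolvent_mxderiv (uA _ (l01 x)))).
  apply: cvgM; last exact: cvg_cst.
  apply: cvgM; first exact: continuous_cosh.
  have cs : sech (sinh y) @[y --> x] --> sech (sinh x).
    apply: cvgV; first by rewrite gt_eqF// cosh_gt0.
    apply: (cvg_comp (@sinh R) (@cosh R) (is_derive_continuous (is_derive_sinh x))).
    exact: continuous_cosh.
  by rewrite expr2; under eq_cvg do rewrite expr2; exact: cvgM.
have := mxderiv_comp (dPhi _ (l01 x)) (is_derive_de_subst x).
by move=> /(_ i j); rewrite FE.
Qed.

End DoubleExponential.

(** * The two truncation errors *)

Section Tails.
Variables (R : realType) (n : nat).
Implicit Types (A E : 'M[R]_n) (u v w : 'cV[R]_n) (t a b : R).

Lemma is_derive_bilinear E (Phi : R -> 'M[R]_n) t dPhi u v :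
  mxderiv Phi t dPhi ->
  is_derive t 1 (fun y => dot u (E *m Phi y *m v)) (dot u (E *m dPhi *m v)).
Proof.
move=> dP; apply: is_derive_bigsum => i.
have := mxderivM (mxderivM (mxderiv_cst E t) dP) (mxderiv_cst v t).
rewrite mul0mx add0r mulmx0 addr0 => /(_ i 0) h.
by have := is_derive_mul (is_derive_cst (u i 0) t 1) h; rewrite mul0r add0r.
Qed.

(** 1 / (1 - q) <= 1 + 2 q on [0, 1/2], as (1 - q) (1 + 2 q) = 1 + q (1 - 2 q). The
    polynomial majorant has an elementary primitive. *)
Lemma geometric_bound (q y : R) : 0 <= q -> q <= 2^-1 ->
  (1 - q) * y <= 1 -> y <= 1 + 2 * q.
Proof.
move=> q0 q2 h; rewrite -(@ler_pM2l _ (1 - q)); last by lra.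
apply: (le_trans h); nra.
Qed.

(** For w = (1 + t E)^-1 v, the triangle inequality gives
    |v| >= (1 - t |E|) |w|. *)
Lemma norm2_resolvent_near0 E t v : norm2 v = 1 -> 0 <= t ->
  t * specnorm E <= 2^-1 -> 1%:M + t *: E \in unitmx ->
  norm2 (invmx (1%:M + t *: E) *m v) <= 1 + 2 * (t * specnorm E).
Proof.
move=> v1 t0 te uE; set w := _ *m v.
have hw : w + t *: (E *m w) = v.
  by rewrite scalemxAl -{1}[w]mul1mx -mulmxDl mulmxA mulmxV// mul1mx.
apply: geometric_bound => //.
  by rewrite mulr_ge0 ?specnorm_ge0.
have := norm2B w (t *: (E *m w)); rewrite hw v1 norm2Z ger0_norm// => h.
apply: le_trans h; rewrite mulrBl mul1r lerB// -mulrA ler_wpM2l//.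
exact: norm2_mulmx.
Qed.

(** Close to t = 1 the dominant term is t A: for z = A (1 + t (A - 1))^-1 v one has
    v = t z + (1 - t) A^-1 z, hence |v| >= t (1 - q) |z| with
    q = (1 - t) |A^-1| / t <= 1/2. *)
Lemma norm2_resolvent_near1 A t v : norm2 v = 1 -> 0 < t <= 1 ->
  A \in unitmx -> (1 - t) * specnorm (invmx A) <= t / 2 ->
  1%:M + t *: (A - 1%:M) \in unitmx ->
  norm2 (A *m (invmx (1%:M + t *: (A - 1%:M)) *m v)) <=
    t^-1 + 2 * specnorm (invmx A) * ((1 - t) / t ^+ 2).
Proof.
move=> v1 /andP[t0 t1] uA tN uC; set w := _ *m v; set N := specnorm _ in tN *.
have hw : t *: (A *m w) + (1 - t) *: (invmx A *m (A *m w)) = v.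
  rewrite [invmx A *m _]mulmxA mulVmx// mul1mx -[RHS]mul1mx -(mulmxV uC) -mulmxA -/w.
  rewrite mulmxDl mul1mx -scalemxAl mulmxBl mul1mx.
  by rewrite scalerBr scalerBl scale1r addrCA.
set z := A *m w in hw *.
have N0 : 0 <= N by exact: specnorm_ge0.
have q0 : 0 <= (1 - t) * N / t.
  by rewrite divr_ge0 ?(ltW t0)// mulr_ge0// subr_ge0.
have q2 : (1 - t) * N / t <= 2^-1.
  by rewrite ler_pdivrMr// [leRHS]mulrC.
have h : (1 - (1 - t) * N / t) * (t * norm2 z) <= 1.
  have := norm2B (t *: z) ((1 - t) *: (invmx A *m z)).
  rewrite hw v1 !norm2Z !ger0_norm ?subr_ge0 ?(ltW t0)// => h.
  apply: le_trans h; rewrite mulrBl mul1r lerB// mulrA divfK ?gt_eqF//.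
  by rewrite -mulrA ler_wpM2l ?subr_ge0// norm2_mulmx.
have := geometric_bound q0 q2 h.
rewrite -ler_pdivlMl// => /le_trans; apply.
by rewrite le_eqVlt; apply/orP; left; apply/eqP; field; rewrite gt_eqF.
Qed.

(** The second order Taylor bound, obtained by differentiating the difference. *)
Lemma log1p_bound (x : R) : 0 <= x -> x - ln (1 + x) <= x ^+ 2 / 2.
Proof.
move=> x0.
pose g y : R := y - ln (1 + y) - y * y * 2^-1.
pose dg y : R := 1 - (1 + y)^-1 - (y + y) * 2^-1.
have h : g x <= g 0.
  apply: (derive_le0_le (df := dg) x0) => y /andP[y0 _].
  - have y1 : 0 < 1 + y by lra.
    have dl : is_derive y 1 (fun z => ln (1 + z)) ((1 + y)^-1).
      have := is_derive_comp (is_derive1_ln y1)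
        (is_derive_add (is_derive_cst (1 : R) y 1) (is_derive_id y 1)).
      by rewrite add0r mulr1.
    have dy2 : is_derive y 1 (fun z : R => z * z * 2^-1) ((y + y) * 2^-1).
      have := is_derive_mul (is_derive_mul (is_derive_id y 1) (is_derive_id y 1))
        (is_derive_cst (2^-1 : R) y 1).
      by rewrite mulr0 addr0 mul1r mulr1.
    exact: is_derive_add (is_derive_add (is_derive_id y 1) (is_derive_opp dl))
      (is_derive_opp dy2).
  - have y1 : 0 < 1 + y by lra.
    rewrite /dg; have -> : 1 - (1 + y)^-1 - (y + y) * 2^-1 = - (y ^+ 2 / (1 + y)).
      by field; rewrite gt_eqF.
    by rewrite oppr_le0 divr_ge0 ?sqr_ge0// ltW.
move: h; rewrite /g addr0 ln1; lra.
Qed.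

Variables (A : 'M[R]_n) (Phi : R -> 'M[R]_n).
Local Notation e := (specnorm (A - 1%:M)).
Local Notation N := (specnorm (invmx A)).
Hypothesis uC : forall t, 0 <= t <= 1 -> 1%:M + t *: (A - 1%:M) \in unitmx.
Hypothesis dPhi : forall t, 0 <= t <= 1 ->
  mxderiv Phi t (invmx (1%:M + t *: (A - 1%:M))).

(** The right-hand side is the integral over [0, a] of the majorant
    e (1 + 2 t e) of |(A - 1) (1 + t (A - 1))^-1|. *)
Lemma lower_tail a u v : norm2 u = 1 -> norm2 v = 1 ->
  0 <= a <= 1 -> a * e <= 2^-1 ->
  dot u ((A - 1%:M) *m Phi a *m v) - dot u ((A - 1%:M) *m Phi 0 *m v)
    <= a * e + (a * e) ^+ 2.
Proof.
move=> u1 v1 /andP[a0 a1] ae.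
have e0 : 0 <= e by exact: specnorm_ge0.
pose g t := dot u ((A - 1%:M) *m Phi t *m v) - (t * e + t * e * (t * e)).
pose dg t := dot u ((A - 1%:M) *m invmx (1%:M + t *: (A - 1%:M)) *m v)
  - (e + (e * (t * e) + t * e * e)).
have dte t : is_derive t 1 (fun y => y * e) e.
  have := is_derive_mul (is_derive_id t 1) (is_derive_cst e t 1).
  by rewrite mul1r mulr0 addr0.
have dgP t : 0 <= t <= a -> is_derive t 1 g (dg t).
  move=> /andP[t0 ta].
  apply: is_derive_add.
    by apply: is_derive_bilinear; apply: dPhi; rewrite t0 (le_trans ta).
  apply: is_derive_opp; apply: is_derive_add => //; exact: is_derive_mul.
have dg0 t : 0 <= t <= a -> dg t <= 0.
  move=> /andP[t0 ta].
  have te : t * e <= 2^-1 by apply: le_trans ae; rewrite ler_wpM2r.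
  have uCt : 1%:M + t *: (A - 1%:M) \in unitmx by rewrite uC// t0 (le_trans ta).
  have h1 := norm2_resolvent_near0 v1 t0 te uCt.
  rewrite /dg subr_le0 -mulmxA; set w := invmx _ *m v in h1 *.
  apply: le_trans (dot_le_norm2 _ _) _; rewrite u1 mul1r.
  apply: le_trans (norm2_mulmx _ _) _.
  apply: le_trans (ler_wpM2l e0 h1) _; lra.
have := derive_le0_le a0 dgP dg0; rewrite /g !mul0r addr0 subr0; lra.
Qed.

(** Since A - 1 is applied to A^-1 z in the notation of [norm2_resolvent_near1],
    the integrand is at most e N (1/t + 2 N (1 - t) / t^2), whose primitive is
    e N P below. Between b and 1 the first term contributes - e N ln b. The second
    contributes e N times 2 N (x - ln (1 + x)) with x = 1/b - 1, and this is at most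
    e N x / 2 because N x <= 1/2. *)
Lemma upper_tail b u v : norm2 u = 1 -> norm2 v = 1 -> A \in unitmx ->
  0 < b <= 1 -> (1 - b) * N <= b / 2 ->
  dot u ((A - 1%:M) *m Phi 1 *m v) - dot u ((A - 1%:M) *m Phi b *m v)
    <= (- ln b + (1 - b) / (2 * b)) * (e * N).
Proof.
move=> u1 v1 uA /andP[b0 b1] bN.
have e0 : 0 <= e by exact: specnorm_ge0.
have N0 : 0 <= N by exact: specnorm_ge0.
pose P t : R := ln t + 2 * N * (- t^-1 - ln t).
pose dP t : R := t^-1 + 2 * N * (t ^- 2 - t^-1).
have dPP t : 0 < t -> is_derive t 1 P (dP t).
  move=> t0.
  have dl : is_derive t 1 (@ln R) t^-1 by exact: is_derive1_ln.
  have dV : is_derive t 1 (fun y : R => y^-1) (- t ^- 2).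
    apply: is_derive_eq (is_deriveV (f := id) (lt0r_neq0 t0) (is_derive_id t 1)) _.
    by rewrite /GRing.scale/= mulr1.
  have := is_derive_add dl (is_derive_mul (is_derive_cst (2 * N) t 1)
    (is_derive_add (is_derive_opp dV) (is_derive_opp dl))).
  by rewrite mul0r add0r opprK.
pose g t := dot u ((A - 1%:M) *m Phi t *m v) - e * N * P t.
pose dg t := dot u ((A - 1%:M) *m invmx (1%:M + t *: (A - 1%:M)) *m v)
  - e * N * dP t.
have dgP t : b <= t <= 1 -> is_derive t 1 g (dg t).
  move=> /andP[bt t1]; have t0 := lt_le_trans b0 bt.
  apply: is_derive_add.
    by apply: is_derive_bilinear; apply: dPhi; rewrite (ltW t0).
  apply: is_derive_opp.
  have := is_derive_mul (is_derive_cst (e * N) t 1) (dPP t t0).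
  by rewrite mul0r add0r.
have dg0 t : b <= t <= 1 -> dg t <= 0.
  move=> /andP[bt t1]; have t0 := lt_le_trans b0 bt.
  have t01 : 0 < t <= 1 by rewrite t0.
  have tN : (1 - t) * N <= t / 2 by nra.
  have uCt : 1%:M + t *: (A - 1%:M) \in unitmx by rewrite uC// ltW.
  have h1 := norm2_resolvent_near1 v1 t01 uA tN uCt.
  rewrite /dg subr_le0 -mulmxA; set w := invmx _ *m v in h1 *.
  apply: le_trans (dot_le_norm2 _ _) _; rewrite u1 mul1r.
  apply: le_trans (norm2_mulmx _ _) _; rewrite -mulrA ler_wpM2l//.
  have {1}-> : w = invmx A *m (A *m w) by rewrite [RHS]mulmxA mulVmx// mul1mx.
  apply: le_trans (norm2_mulmx _ _) _; rewrite ler_wpM2l//.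
  apply: le_trans h1 _; rewrite le_eqVlt; apply/orP; left; apply/eqP.
  by rewrite /dP; field; rewrite gt_eqF.
have := derive_le0_le b1 dgP dg0; rewrite /g /P ln1 invr1 => hg.
have hP : - (2 * N) - (ln b + 2 * N * (- b^-1 - ln b)) <= - ln b + (1 - b) / (2 * b).
  have x0 : 0 <= b^-1 - 1 by rewrite subr_ge0 invf_ge1.
  have := log1p_bound x0; rewrite addrCA subrr addr0 lnV ?posrE// opprK.
  set x := b^-1 - 1 in x0 * => hx.
  have -> : (1 - b) / (2 * b) = x / 2 by rewrite /x; field; rewrite gt_eqF.
  have Nx : N * x <= 2^-1.
    rewrite /x; have -> : N * (b^-1 - 1) = (1 - b) * N / b.
      by field; rewrite gt_eqF.
    by rewrite ler_pdivrMr// [leRHS]mulrC.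
  have -> : b^-1 = x + 1 by rewrite /x subrK.
  nra.
have eN : 0 <= e * N by rewrite mulr_ge0.
have := ler_wpM2l eN hP; lra.
Qed.

End Tails.

(** * The error estimate *)

(** A positive norm certifies existence: if there were no principal logarithm,
    [logmx A] would be the default matrix, which is 0. *)
Lemma logmxP (R : realType) (n : nat) (A : 'M[R]_n) :
  0 < specnorm (logmx A) -> is_principal_log A (logmx A).
Proof.
have [hex _|nex] := pselect (exists X, is_principal_log A X).
  exact: (getPex hex).
have -> : logmx A = 0.
  rewrite /logmx getPN => [|X hX]; last by apply: nex; exists X.
  by apply/matrixP => i j; rewrite !mxE.
by rewrite specnorm0 ltxx.
Qed.

Theorem proposition2p2 (R : realType) (n : nat) (A : 'M[R]_n)
    (theta epsilon s : R)
    (hA : forall z : R[i], complex_eigenvalue A z ->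
            ~ (complex.Im z = 0 /\ complex.Re z <= 0))
    (hA1 : A <> 1%:M)
    (htheta : 0 < theta)
    (htheta_log : theta <= specnorm (logmx A))
    (hepsilon : 0 < epsilon)
    (hepsilon_lt : epsilon <
       3 * specnorm (A - 1%:M) * specnorm (invmx A)
         / (theta * (1 + specnorm (invmx A))))
    (hs : 0 < s)
    (hs_eq : theta^-1 * (- ln s + (1 - s) / (2 * s))
               * specnorm (A - 1%:M) * specnorm (invmx A) = epsilon / 2) :
  let a := Num.min (theta * epsilon / (3 * specnorm (A - 1%:M)))
                   (1 / (2 * specnorm (A - 1%:M))) in
  let b := Num.max s (2 * specnorm (invmx A) / (2 * specnorm (invmx A) + 1)) in
  let l := asinh (atanh (2 * a - 1)) in
  let r := asinh (atanh (2 * b - 1)) in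
  specnorm (logmx A - (A - 1%:M) *m integral_mx l r (F_DE A))
    / specnorm (logmx A) <= epsilon.
Proof.
cbv zeta; set a := Num.min _ _; set b := Num.max _ _.
set l := asinh (atanh (2 * a - 1)); set r := asinh _.
have L0 : 0 < specnorm (logmx A) by exact: lt_le_trans htheta htheta_log.
have [uC logE] := log_integral (logmxP L0).
set e := specnorm (A - 1%:M) in hepsilon_lt hs_eq a b l r *.
set N := specnorm (invmx A) in hepsilon_lt hs_eq a b l r *.
have uA : A \in unitmx.
  by have := uC 1; rewrite scale1r addrC subrK; apply; rewrite ler01 lexx.
have e0 : 0 < e by apply: specnorm_gt0 => /eqP; rewrite subr_eq0 => /eqP.
have N0 : 0 < N.
  apply: specnorm_gt0 => iA0; have A0 : A = 0.
    by rewrite -[A]mulmx1 -(mulmxV uA) iA0 !mulmx0.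
  apply: hA1; rewrite A0; move: (mulmxV uA); rewrite iA0 mulmx0; exact.
have [Phi dPhi] := resolvent_primitive uC.
have XE : logmx A = (A - 1%:M) *m (Phi 1 - Phi 0).
  apply/matrixP => i j; rewrite logE mulmxBr.
  have dF (t : R) : 0 <= t <= 1 ->
    is_derive t 1 (fun y : R => ((A - 1%:M) *m Phi y) i j)
      (((A - 1%:M) *m invmx (1%:M + t *: (A - 1%:M))) i j).
    move=> t01; have := mxderivM (mxderiv_cst (A - 1%:M) t) (dPhi t t01).
    by move=> /(_ i j); rewrite mul0mx add0r.
  have cF (t : R) : 0 <= t <= 1 -> {for t, continuous
      (fun y : R => ((A - 1%:M) *m invmx (1%:M + y *: (A - 1%:M))) i j)}.
    move=> t01; apply: is_derive_continuous.
    exact: (mxderivM (mxderiv_cst _ t) (resolvent_mxderiv (uC t t01))).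
  by rewrite (Rintegral_FTC ler01 cF dF) [RHS]mxE [X in _ = _ + X]mxE.
have ae1 : a * e <= theta * epsilon / 3.
  rewrite -ler_pdivlMr// ge_min; apply/orP; left.
  by rewrite le_eqVlt; apply/orP; left; apply/eqP; field; rewrite gt_eqF.
have ae2 : a * e <= 2^-1.
  rewrite -ler_pdivlMr// ge_min; apply/orP; right.
  by rewrite le_eqVlt; apply/orP; left; apply/eqP; field; rewrite gt_eqF.
have a0 : 0 < a by rewrite lt_min !divr_gt0// !mulr_gt0.
have a1 : a < 1.
  rewrite gt_min; apply/orP; left; rewrite ltr_pdivrMr ?mulr_gt0// mul1r.
  have d0 : 0 < theta * (1 + N) by rewrite mulr_gt0// addr_gt0.
  move: hepsilon_lt; rewrite ltr_pdivlMr// => h.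
  rewrite -(@ltr_pM2r _ (1 + N)) ?addr_gt0//.
  apply: (@lt_trans _ _ (3 * e * N)); first by lra.
  by rewrite ltr_pM2l ?mulr_gt0// ltrDr.
pose rho x : R := - ln x + (1 - x) / (2 * x).
have rho_s : rho s * (e * N) = theta * epsilon / 2.
  have : theta * (theta^-1 * rho s * e * N) = theta * (epsilon / 2).
    by rewrite hs_eq.
  by rewrite !mulrA mulfV ?gt_eqF// mul1r.
have s1 : s < 1.
  rewrite ltNge; apply/negP => s1.
  have : 0 < rho s * (e * N) by rewrite rho_s divr_gt0// mulr_gt0.
  apply/negP; rewrite -leNgt mulr_le0_ge0 ?mulr_ge0 ?(ltW e0) ?(ltW N0)//.
  have : 0 <= ln s by exact: ln_ge0.
  have : (1 - s) / (2 * s) <= 0.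
    by rewrite mulr_le0_ge0 ?subr_le0// invr_ge0 mulr_ge0// ltW.
  rewrite /rho; lra.
have d0 : 0 < 2 * N + 1 by rewrite addr_gt0// mulr_gt0.
have b0 : 0 < b by rewrite lt_max hs.
have b1 : b < 1.
  by rewrite gt_max s1/= ltr_pdivrMr// mul1r ltrDl.
have bN : (1 - b) * N <= b / 2.
  have : 2 * N / (2 * N + 1) <= b by rewrite le_max lexx orbT.
  rewrite ler_pdivrMr//; lra.
have sb : s <= b by rewrite le_max lexx.
have rho_b : rho b <= rho s.
  apply: lerD; first by rewrite lerN2 ler_ln.
  have rE (x : R) : 0 < x -> (1 - x) / (2 * x) = (x^-1 - 1) / 2.
    by move=> x0; field; rewrite gt_eqF.
  by rewrite !rE// ler_wpM2r// lerB// lef_pV2.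
rewrite ler_pdivrMr//.
apply: (@le_trans _ _ (epsilon * theta)); last by rewrite ler_wpM2l// ltW.
rewrite (integral_F_DE l r uC dPhi) /l /r !de_subst_asinh_atanh ?a0 ?b0// XE.
apply: specnorm_le_dot => [|u v u1 v1]; first by rewrite mulr_ge0// ltW.
have a01 : 0 <= a <= 1 by rewrite !ltW.
have b01 : 0 < b <= 1 by rewrite b0 ltW.
have lo := lower_tail uC dPhi u1 v1 a01 ae2.
have up := upper_tail uC dPhi u1 v1 uA b01 bN.
have rho_eN : rho b * (e * N) <= rho s * (e * N).
  by rewrite ler_wpM2r// mulr_ge0 ?ltW.
have -> : dot u (((A - 1%:M) *m (Phi 1 - Phi 0)
      - (A - 1%:M) *m (Phi b - Phi a)) *m v) =
    (dot u ((A - 1%:M) *m Phi a *m v) - dot u ((A - 1%:M) *m Phi 0 *m v)) +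
    (dot u ((A - 1%:M) *m Phi 1 *m v) - dot u ((A - 1%:M) *m Phi b *m v)).
  rewrite !mulmxBr !mulmxBl !dotBr.
  set p1 := dot u (_ *m Phi 1 *m v); set p0 := dot u (_ *m Phi 0 *m v).
  set pb := dot u (_ *m Phi b *m v); set pa := dot u (_ *m Phi a *m v).
  by clearbody p1 p0 pb pa; clear; ring.
have a00 : 0 <= a * e by rewrite mulr_ge0 ?ltW.
have ae_sq : (a * e) ^+ 2 <= 2^-1 * (a * e) by rewrite expr2 ler_wpM2r.
(* Each tail is worth theta * epsilon / 2: the lower one as
   x + x ^+ 2 <= 3 x / 2 for x = a * e, the upper one by the equation for s. *)
rewrite (splitr (epsilon * theta)); apply: lerD.
  apply: le_trans lo _; apply: le_trans (lerD (lexx _) ae_sq) _.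
  move: ae1; rewrite [epsilon * _]mulrC; move: (a * e) (theta * epsilon) => x y.
  by clear; lra.
apply: le_trans up _; apply: le_trans rho_eN _.
by rewrite rho_s [epsilon * _]mulrC.
Qed.
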